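(* Assume the map $\theta$ is invertible, and put $\psi_t(y) := \int_X g\circ\varphi_t \, dP_{\theta^{-1}(y)}$ for $t\in T$, $y\in(y_{\min},y_{\max})$, where $T$ is unbounded above. Suppose $\mu$ is invariant under each $\varphi_t$ and $\{\varphi_t:t\in T\}$ is mixing with respect to $\mu$. Then for every $y\in(y_{\min},y_{\max})$, $$\lim_{t\to\infty}\psi_t(y)=\int_X g\,d\mu = y_*.$$ If moreover $T=-T$ and each $\varphi_t$ is invertible with $\varphi_t^{-1}=\varphi_{-t}$, then also $\lim_{t\to-\infty}\psi_t(y)=y_*$.
   Context: Setting. $(X,d)$ is a complete separable metric space with its Borel $\sigma$-algebra and $\mu$ is a Borel probability measure on $X$. $g: X\to\mathbb{R}$ is measurable, bounded, and continuous $\mu$-almost everywhere (i.e. its set of discontinuity points is $\mu$-null). $y_{\min}=\inf g(X)$, $y_{\max}=\sup g(X)$, $Y=[y_{\min},y_{\max}]$, $y_*=\int_X g\,d\mu$. $T\subseteq\mathbb{R}$ is a set of times with $0\in T$; for each $t\in T$, $\varphi_t:X\to X$ is measurable and continuous $\mu$-a.e., with $\varphi_0=\mathrm{id}$. $\mu$ is invariant under $\varphi_t$ if $\mu\circ\varphi_t^{-1}=\mu$. The family $\{\varphi_t:t\in T\}$ is mixing with respect to $\mu$ if $\lim_{t\to\infty}\mu[\varphi_t^{-1}(A)\cap B]=\mu[A]\,\mu[B]$ for all measurable $A,B\subseteq X$. Limits $t\to\pm\infty$ are along $t\in T$. Canonical measures. For $\lambda\in\mathbb{R}$, $Z(\lambda)=\int_X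 e^{\lambda g}\,d\mu$ and $P_\lambda$ is the probability measure with $dP_\lambda = \frac{e^{\lambda g}}{Z(\lambda)}\,d\mu$. The map $\theta:[-\infty,+\infty]\to Y$ is given by $\theta(\lambda)=\int_X g\,dP_\lambda$ for $\lambda\in\mathbb{R}$, $\theta(-\infty)=y_{\min}$, $\theta(+\infty)=y_{\max}$. *)

(* Defs.v *)
From HB Require Import structures.
From mathcomp Require Import all_boot all_order all_algebra.
From mathcomp Require Import all_classical all_reals all_analysis.
From mathcomp Require Import measurable_realfun.

Set Implicit Arguments.
Unset Strict Implicit.
Unset Printing Implicit Defensive.

Import Order.TTheory GRing.Theory Num.Theory.
Import numFieldNormedType.Exports.

Local Open Scope classical_set_scope.
Local Open Scope ring_scope.

(* Complete spaces are pointed in MathComp-Analysis; this is no restriction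
   for a space carrying a probability measure. *)
#[short(type="completeMetricType")]
HB.structure Definition CompleteMetric (R : numDomainType) :=
  {X of Metric R X & Complete X}.

Definition separable (X : topologicalType) : Prop :=
  exists2 D : set X, countable D & dense D.

(* [borel X] is convertible to [X]: the topology is found on [X] and the
   sigma-algebra generated by the open sets on [borel X]. *)
Notation borel X := (g_sigma_algebraType (@open X)).

Section canonical_measures.
Context {d : measure_display} {T : measurableType d} {R : realType}.
Context (mu : probability T R) (g : {mfun T >-> R}).

Definition partition_function (lambda : R) : R :=
  \int[mu]_x expR (lambda * g x).

Definition canonical_density (lambda : R) (x : T) : R :=
  expR (lambda * g x) / partition_function lambda.

Definition canonical_measure (lambda : R) : set T -> \bar R :=
  fun A => (\int[mu]_(x in A) (canonical_density lambda x)%:E)%E.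

Lemma partition_function_ge0 lambda : 0 <= partition_function lambda.
Proof. by apply: Rintegral_ge0 => x _; exact: expR_ge0. Qed.

Lemma canonical_density_ge0 lambda x : 0 <= canonical_density lambda x.
Proof. by rewrite divr_ge0 ?expR_ge0 ?partition_function_ge0. Qed.

Lemma measurable_expR_mfun lambda :
  measurable_fun setT (fun x => expR (lambda * g x)).
Proof. by apply: measurableT_comp => //; exact: measurable_funM. Qed.

Lemma measurable_canonical_density lambda :
  measurable_fun setT (canonical_density lambda).
Proof. by apply: measurable_funM => //; exact: measurable_expR_mfun. Qed.

Lemma canonical_measure0 lambda : canonical_measure lambda set0 = 0%E.
Proof. by rewrite /canonical_measure integral_set0. Qed.

Lemma canonical_measure_ge0 lambda A : (0 <= canonical_measure lambda A)%E.
Proof.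
by apply: integral_ge0 => x _; rewrite lee_fin canonical_density_ge0.
Qed.

Lemma canonical_measure_sigma_additive lambda :
  semi_sigma_additive (canonical_measure lambda).
Proof.
move=> /= A mA tA mUA.
rewrite /canonical_measure ge0_integral_bigcup//=; last 2 first.
- apply/measurable_EFinP/measurable_funTS.
  exact: measurable_canonical_density.
- by move=> x _; rewrite lee_fin canonical_density_ge0.
apply: is_cvg_ereal_nneg_natsum_cond => n _ _.
by apply: integral_ge0 => x _; rewrite lee_fin canonical_density_ge0.
Qed.

HB.instance Definition _ lambda := isMeasure.Build _ _ _
  (canonical_measure lambda) (canonical_measure0 lambda)
  (canonical_measure_ge0 lambda) (@canonical_measure_sigma_additive lambda).

Lemma bounded_fun_mfunP : bounded_fun g ->
  exists M : R, forall x, `|g x| <= M.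
Proof.
move=> [M [_ gM]]; exists (M + 1) => x.
by apply: (gM (M + 1)) => //; rewrite ltrDl.
Qed.

Lemma integrable_expR_mfun lambda : bounded_fun g ->
  mu.-integrable setT (fun x => (expR (lambda * g x))%:E).
Proof.
move=> /bounded_fun_mfunP[M gM].
apply: (measurable_bounded_integrable (f := fun x => expR (lambda * g x))) => //.
- by rewrite (@le_lt_trans _ _ 1%E) ?probability_le1 ?ltry.
- exact: measurable_expR_mfun.
exists (expR (`|lambda| * M)); split; first exact: num_real.
move=> N MN x _ /=; rewrite ger0_norm ?expR_ge0// (le_trans _ (ltW MN))//.
by rewrite ler_expR (le_trans (ler_norm _))// normrM ler_wpM2l.
Qed.

Lemma partition_functionE lambda : bounded_fun g ->
  (\int[mu]_x (expR (lambda * g x))%:E = (partition_function lambda)%:E)%E.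
Proof.
by move=> /(integrable_expR_mfun lambda) ig; rewrite fineK ?integrable_fin_num.
Qed.

Lemma partition_function_gt0 lambda : bounded_fun g ->
  0 < partition_function lambda.
Proof.
move=> gb; have [M gM] := bounded_fun_mfunP gb.
rewrite -lte_fin -partition_functionE//.
apply: (@lt_le_trans _ _ (\int[mu]_x (expR (- (`|lambda| * M)))%:E)%E).
  by rewrite integral_cst//= probability_setT mule1 lte_fin expR_gt0.
apply: ge0_le_integral => //.
- by apply/measurable_EFinP; exact: measurable_expR_mfun.
- move=> x _; rewrite lee_fin ler_expR lerNl (le_trans (ler_norm _))//.
  by rewrite normrN normrM ler_wpM2l.
Qed.

Lemma canonical_measure_setT lambda : bounded_fun g ->
  canonical_measure lambda setT = 1%E.
Proof.
move=> gb; rewrite /canonical_measure /canonical_density.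
under eq_integral do rewrite mulrC EFinM.
rewrite integralZl//; last exact: integrable_expR_mfun.
by rewrite partition_functionE// -EFinM mulVf// gt_eqF// partition_function_gt0.
Qed.

Definition y_min : R := inf (range g).
Definition y_max : R := sup (range g).
Definition y_star : R := \int[mu]_x g x.

Definition theta (lambda : \bar R) : R :=
  match lambda with
  | l%:E => \int[canonical_measure l]_x g x
  | -oo%E => y_min
  | +oo%E => y_max
  end.

Definition theta_invertible : Prop := set_bij setT `[y_min, y_max] theta.

Definition theta_inv : R -> \bar R := 'pinv_(fun=> 0%E) setT theta.

(* [fine] reads [theta_inv y] as a real number: under [theta_invertible] it is
   finite for [y_min < y < y_max], the only values of [y] considered. *)
Definition psi (phi : R -> T -> T) (t y : R) : R :=
  \int[canonical_measure (fine (theta_inv y))]_x g (phi t x).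

Definition invariant_measure (f : T -> T) : Prop :=
  forall A, measurable A -> pushforward mu f A = mu A.

(* Limits along a set of times [S] are limits along [within S +oo]. *)
Definition mixing (S : set R) (phi : R -> T -> T) : Prop :=
  forall A B, measurable A -> measurable B ->
  mu (phi t @^-1` A `&` B) @[t --> within S +oo] --> (mu A * mu B)%E.

End canonical_measures.

(* Main.v *)
(* Only the form of the canonical measure matters, not the value of the
   parameter: for every real lambda the expectation of g o phi_t under P_lambda
   tends to the mu-mean of g, because P_lambda has a bounded density h with
   respect to mu.  Mixing says that B |-> mu (phi_t^-1 A `&` B) converges
   setwise to mu A * mu; integrating h against this gives
   P_lambda (phi_t^-1 A) --> mu A, i.e. the law of phi_t under P_lambda
   converges setwise to mu, and integrating g against that gives the theorem. *)
Require Import Defs.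
From HB Require Import structures.
From mathcomp Require Import all_boot all_order all_algebra.
From mathcomp Require Import all_classical all_reals all_analysis.
From mathcomp Require Import measurable_realfun lra.
Import Order.TTheory GRing.Theory Num.Theory.
Import numFieldNormedType.Exports.
Local Open Scope classical_set_scope.
Local Open Scope ring_scope.

(** * Bounded functions against measures of mass at most one *)

Lemma integrable_bounded_le1 {d} {T : measurableType d} {R : realType}
    (m : {measure set T -> \bar R}) (D : set T) (u : T -> R) (k : R) :
  (m setT <= 1)%E -> measurable D -> measurable_fun setT u ->
  (forall x, `|u x| <= k) -> m.-integrable D (EFin \o u).
Proof.
move=> m1 mD mu uk; apply: measurable_bounded_integrable => //.
- apply: (@le_lt_trans _ _ (m setT)); last by rewrite (le_lt_trans m1)// ltry.
  by apply: le_measure; rewrite ?inE.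
- exact: measurable_funTS.
- exists k; split; first exact: num_real.
  by move=> N kN x _ /=; rewrite (le_trans (uk x))// ltW.
Qed.

(** A mass bound is assumed instead of a [probability] structure so that this also applies to
    [canonical_measure], which is declared only as a measure. *)
Lemma Rintegral_ge0_le {d} {T : measurableType d} {R : realType}
    (m : {measure set T -> \bar R}) (D : set T) (u : T -> R) (k : R) :
  (m setT <= 1)%E -> measurable D -> measurable_fun setT u ->
  (forall x, 0 <= u x <= k) -> 0 <= \int[m]_(x in D) u x <= k.
Proof.
move=> m1 mD mu uk; have k0 : 0 <= k.
  by have /andP[] := uk point; exact: le_trans.
have mD1 : (m D <= 1)%E.
  by rewrite (le_trans _ m1)//; apply: le_measure; rewrite ?inE.
rewrite Rintegral_ge0/=; last by move=> x _; have /andP[] := uk x.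
rewrite (@le_trans _ _ (\int[m]_(x in D) k))//.
  apply: le_Rintegral => //.
  - apply: (integrable_bounded_le1 _ _ _ k) => // x.
    by have /andP[? ?] := uk x; rewrite ger0_norm.
  - apply: (integrable_bounded_le1 _ _ _ k) => // x; rewrite ?ger0_norm//.
  - by move=> x _; have /andP[] := uk x.
rewrite Rintegral_cst// ler_piMr// -lee_fin fineK//.
by rewrite ge0_fin_numE// (le_lt_trans mD1)// ltry.
Qed.

(** * From setwise convergence of measures to convergence of integrals *)

Section setwise_convergence.
Context {d d'} {S : measurableType d} {T : measurableType d'} {R : realType}.
Context {I : Type} (F : set_system I) {FF : Filter F}.
Context (nu : {measure set S -> \bar R}) (m : {measure set T -> \bar R}).
Context (D : I -> set S) (f : I -> S -> T) (c : R).
Hypothesis nu1 : (nu setT <= 1)%E.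
Hypothesis m1 : (m setT <= 1)%E.
Hypothesis c01 : 0 <= c <= 1.
Hypothesis mD : \forall i \near F, measurable (D i).
Hypothesis mf : \forall i \near F, measurable_fun setT (f i).
Hypothesis cvg_nu : forall B, measurable B ->
  nu (f i @^-1` B `&` D i) @[i --> F] --> (c%:E * m B)%E.

(* Subtracting [k / 2] on [k / 2 <= u] leaves a function with values in
   [0, k / 2], so each step of the induction halves the error. *)
Let cvg_Rintegral_halving n : forall (k : R) (u : T -> R),
  measurable_fun setT u -> (forall x, 0 <= u x <= k) ->
  forall e : R, 0 < e -> \forall i \near F,
  `|\int[nu]_(x in D i) u (f i x) - c * \int[m]_x u x| <= k / 2 ^+ n + e.
Proof.
elim: n => [|n ih] k u mu uk e e0.
  near=> i.
  have mDi : measurable (D i) by near: i.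
  have mfi : measurable_fun setT (f i) by near: i.
  (* Base case: both integrals lie in [[0, k]] and [c] in [[0, 1]], so they differ by at most
     [k]. *)
  have /andP[i0 ik] := Rintegral_ge0_le nu (D i) (u \o f i) k nu1 mDi
    (measurableT_comp mu mfi) (fun x => uk (f i x)).
  have /andP[j0 jk] := Rintegral_ge0_le m setT u k m1 measurableT mu uk.
  rewrite /= in i0 ik; rewrite expr0 divr1 ler_norml.
  by case/andP: c01 => c0 c1; nra.
pose A := [set x | k / 2 <= u x].
have mA : measurable A.
  rewrite [A](_ : _ = setT `&` u @^-1` `[k / 2, +oo[).
    by apply: mu => //; exact: measurable_itv.
  by rewrite setTI; apply/seteqP; split => x /=; rewrite in_itv/= andbT.
pose v x := u x - k / 2 * \1_A x.
have k0 : 0 <= k by have /andP[] := uk point; exact: le_trans.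
have mv : measurable_fun setT v.
  apply: measurable_funB => //; apply: measurable_funM => //.
have vk x : 0 <= v x <= k / 2.
  have /andP[u0 uk'] := uk x; rewrite /v indicE.
  have [xA|xA] := boolP (x \in A); rewrite ?mulr1 ?mulr0 ?subr0.
    by rewrite inE /A/= in xA; lra.
  have : ~ A x by move=> Ax; move: xA; rewrite notin_setE.
  by rewrite /A/= => /negP; rewrite -ltNge; lra.
(* Stated for any measure and map, as it is used both for [nu] with [f i] on [D i] and for [m] with
   [id] on [setT]. *)
have uE (d0 : measure_display) (S0 : measurableType d0) (p : {measure set S0 -> \bar R}) E
    (h : S0 -> T) : (p setT <= 1)%E -> measurable E -> measurable_fun setT h ->
    \int[p]_(x in E) u (h x) =
    \int[p]_(x in E) v (h x) + k / 2 * fine (p (h @^-1` A `&` E)).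
  move=> p1 mE mh.
  have mhA : measurable (h @^-1` A) by rewrite -[X in measurable X]setTI; exact: mh.
  have iA : p.-integrable E (EFin \o \1_(h @^-1` A)).
    apply: (integrable_bounded_le1 _ _ _ 1) => // x.
    by rewrite indicE; case: (_ \in _); rewrite ?normr1 ?normr0.
  rewrite -[X in fine X](integral_indic p mE mhA) -/(Rintegral p E _).
  rewrite -RintegralZl// -RintegralD//.
  - by apply: eq_Rintegral => x _; rewrite /v indicE/= subrK.
  - apply: (integrable_bounded_le1 _ _ _ (k / 2)) => //.
      exact: (measurableT_comp mv mh).
    by move=> x; have /andP[? ?] := vk (h x); rewrite ger0_norm.
  - exact: (integrableZl mE (k / 2) iA).
have e2 : 0 < e / 2 by lra.
(* Tolerance for the indicator part, whose coefficient is [k / 2]: its contribution stays below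
   [e / 2]. The [+ 1] covers [k = 0]. *)
have ke0 : 0 < e / (k + 1) by rewrite divr_gt0; lra.
have mA_fin : m A \is a fin_num.
  rewrite ge0_fin_numE// (@le_lt_trans _ _ 1%E) ?ltry// (le_trans _ m1)//.
  by apply: le_measure; rewrite ?inE.
have cA : fine (nu (f i @^-1` A `&` D i)) @[i --> F] --> c * fine (m A).
  by apply: fine_cvg; rewrite EFinM fineK//; exact: cvg_nu.
have uEm := uE _ _ m setT id m1 measurableT (@measurable_id _ _ _).
rewrite preimage_id setIT in uEm.
near=> i.
rewrite uE//; [|by near: i..]; rewrite uEm.
(* The induction hypothesis for [v], bounded by [k / 2], takes the other half of [e]. *)
have iv : `|\int[nu]_(x in D i) v (f i x) - c * \int[m]_x v x|
          <= k / 2 / 2 ^+ n + e / 2.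
  by near: i; exact: ih.
have iA : `|c * fine (m A) - fine (nu (f i @^-1` A `&` D i))| <= e / (k + 1).
  by near: i; move/cvgrPdist_le : cA; exact.
set a := \int[nu]_(x in _) _ in iv *; set b := \int[m]_x _ in iv *.
set p := fine (nu _) in iA *; set q := fine (m A) in iA *.
have -> : a + k / 2 * p - c * (b + k / 2 * q) =
  (a - c * b) - k / 2 * (c * q - p) by lra.
rewrite (le_trans (ler_normB _ _))// normrM (ger0_norm (_ : 0 <= k / 2)); last lra.
have : k / 2 * `|c * q - p| <= e / 2.
  rewrite (@le_trans _ _ (k / 2 * (e / (k + 1))))//.
    by rewrite ler_wpM2l//; lra.
  rewrite mulrA ler_pdivrMr; last lra.
  nra.
have -> : k / 2 ^+ n.+1 = k / 2 / 2 ^+ n by rewrite exprS invfM mulrA.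
lra.
Unshelve. all: by end_near. Qed.

(** With [n] so large that [k / 2 ^+ n <= e / 2], the halving estimate at tolerance [e / 2] bounds
    the error by [e]. *)
Let cvg_Rintegral_ge0 (k : R) (u : T -> R) :
  measurable_fun setT u -> (forall x, 0 <= u x <= k) ->
  \int[nu]_(x in D i) u (f i x) @[i --> F] --> c * \int[m]_x u x.
Proof.
move=> mu uk; apply/cvgrPdist_le => e e0.
have e2 : 0 < e / 2 by lra.
have k0 : 0 <= k by have /andP[] := uk point; exact: le_trans.
have [n kn] : exists n, k / 2 ^+ n <= e / 2.
  have /cvgrPdist_le/(_ _ e2)[n _ /(_ n (leqnn n))/=] :=
    @cvg_geometric R k 2^-1 ltac:(by rewrite ger0_norm; lra).
  rewrite sub0r normrN exprVn => kn; exists n.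
  exact: le_trans (ler_norm _) kn.
have := cvg_Rintegral_halving n k u mu uk _ e2.
by apply: filterS => i; rewrite distrC => /le_trans; apply; lra.
Qed.

(** Adding a constant [k] makes [u] nonnegative, and the integral of [k] converges too, so it can be
    subtracted again. Having both [D] and [f] allows two uses: a moving domain with [f] the
    identity, and a moving map on the whole space. *)
Lemma cvg_Rintegral_setwise (u : T -> R) :
  measurable_fun setT u -> bounded_fun u ->
  \int[nu]_(x in D i) u (f i x) @[i --> F] --> c * \int[m]_x u x.
Proof.
(* [bounded_fun] bounds [u] only by numbers strictly above [M], and [M] may be negative; this [k]
   settles both. *)
move=> mu [M [_ uM]]; pose k := `|M| + 1.
have uk x : `|u x| <= k.
  by apply: (uM k) => //; rewrite /k (le_lt_trans (ler_norm M))// ltrDl.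
have k0 : 0 <= k by rewrite addr_ge0.
have mv : measurable_fun setT (fun x => u x + k) by exact: measurable_funD.
have cvgk : \int[nu]_(x in D i) k @[i --> F] --> c * \int[m]_x k.
  by apply: (cvg_Rintegral_ge0 k (cst k)) => // x; rewrite k0 lexx.
have cvgv : \int[nu]_(x in D i) (u (f i x) + k) @[i --> F] -->
    c * \int[m]_x (u x + k).
  apply: (cvg_Rintegral_ge0 (k + k) (fun x => u x + k) mv) => x.
  by have := uk x; rewrite ler_norml; lra.
have ikm : m.-integrable setT (EFin \o cst k).
  by apply: (integrable_bounded_le1 _ _ _ k) => // x; rewrite ger0_norm.
have ium : m.-integrable setT (EFin \o u).
  exact: (integrable_bounded_le1 _ _ _ k).
have -> : c * \int[m]_x u x = c * \int[m]_x (u x + k) - c * \int[m]_x k.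
  by rewrite RintegralD// -mulrBr addrK.
apply: cvg_trans (cvgB cvgv cvgk); apply: near_eq_cvg; near=> i.
have mDi : measurable (D i) by near: i.
have mfi : measurable_fun setT (f i) by near: i.
rewrite !fctE RintegralD// ?addrK//.
- by apply: (integrable_bounded_le1 _ _ _ k) => //; exact: (measurableT_comp mu mfi).
- by apply: (integrable_bounded_le1 _ _ _ k) => // x; rewrite ger0_norm.
Unshelve. all: by end_near. Qed.

End setwise_convergence.

(** * Relaxation of canonical expectations under mixing *)

Section canonical_relaxation.
Context {d} {X : measurableType d} {R : realType}.
Context (mu : probability X R) (g : {mfun X >-> R}).
Hypothesis g_bounded : bounded_fun g.

(** If [|g| <= M] then [lambda * g <= |lambda| * M], which bounds the numerator; the denominator is
    a constant. *)
Lemma bounded_canonical_density lambda :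
  bounded_fun (canonical_density mu g lambda).
Proof.
have [M gM] := bounded_fun_mfunP g_bounded.
exists (expR (`|lambda| * M) / partition_function mu g lambda).
split; first exact: num_real.
move=> N MN x _ /=; rewrite ger0_norm ?canonical_density_ge0//.
rewrite (le_trans _ (ltW MN))// ler_wpM2r ?invr_ge0 ?partition_function_ge0//.
by rewrite ler_expR (le_trans (ler_norm _))// normrM ler_wpM2l.
Qed.

Lemma integrable_canonical_density lambda A : measurable A ->
  mu.-integrable A (EFin \o canonical_density mu g lambda).
Proof.
move=> mA; apply: measurable_bounded_integrable => //.
- by rewrite (@le_lt_trans _ _ 1%E) ?probability_le1 ?ltry.
- exact/measurable_funTS/measurable_canonical_density.
- have [M [Mr bM]] := bounded_canonical_density lambda.
  by exists M; split=> // N MN x _; exact: bM.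
Qed.

Lemma canonical_measureE lambda A : measurable A ->
  canonical_measure mu g lambda A =
  (\int[mu]_(x in A) canonical_density mu g lambda x)%:E.
Proof.
move=> mA; rewrite fineK//; apply: integrable_fin_num => //.
exact: integrable_canonical_density.
Qed.

Context {I : Type} (F : set_system I) {FF : Filter F} (phi : I -> X -> X).
Hypothesis mphi : \forall i \near F, measurable_fun setT (phi i).
Hypothesis mixing_phi : forall A B, measurable A -> measurable B ->
  mu (phi i @^-1` A `&` B) @[i --> F] --> (mu A * mu B)%E.

Lemma cvg_canonical_measure_preimage lambda A : measurable A ->
  canonical_measure mu g lambda (phi i @^-1` A) @[i --> F] --> mu A.
Proof.
move=> mA.
have mphiA : \forall i \near F, measurable (phi i @^-1` A).
  by apply: filterS mphi => i mi; rewrite -[X in measurable X]setTI; exact: mi.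
have c01 : 0 <= fine (mu A) <= 1.
  by rewrite fine_ge0//= -lee_fin fineK ?fin_num_measure// probability_le1.
have c1 : (mu setT <= 1)%E by rewrite probability_le1.
have cvgA : \int[mu]_(x in phi i @^-1` A) canonical_density mu g lambda x
    @[i --> F] --> fine (mu A) * \int[mu]_x canonical_density mu g lambda x.
  apply: (@cvg_Rintegral_setwise _ _ _ _ R I F FF mu mu
    (fun i => phi i @^-1` A) (fun=> id)) => //.
  - exact: nearW.
  - move=> B mB; rewrite fineK ?fin_num_measure//.
    apply: cvg_trans (mixing_phi _ _ mA mB); apply: near_eq_cvg.
    by apply: nearW => i; rewrite setIC.
  - exact: measurable_canonical_density.
  - exact: bounded_canonical_density.
have density1 : \int[mu]_x canonical_density mu g lambda x = 1.
  by apply: EFin_inj; rewrite -canonical_measureE// canonical_measure_setT.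
rewrite density1 mulr1 in cvgA.
rewrite -[mu A]fineK ?fin_num_measure//; apply/fine_cvgP; split.
  by apply: filterS mphiA => i mi; rewrite canonical_measureE.
apply: cvg_trans cvgA; apply: near_eq_cvg.
by apply: filterS mphiA => i mi; rewrite /= canonical_measureE.
Qed.

(** The filter [F] is arbitrary so that the result covers both ends of time; measurability is asked
    only near [F] because [phi t] is constrained only for [t] in [T]. *)
Lemma cvg_canonical_expectation lambda :
  \int[canonical_measure mu g lambda]_x g (phi i x) @[i --> F] --> y_star mu g.
Proof.
rewrite -[y_star mu g]mul1r.
(* Second use: the domain is the whole space, the map [phi i] moves, and [c = 1]. *)
apply: (@cvg_Rintegral_setwise _ _ _ _ R I F FF (canonical_measure mu g lambda)
  mu (fun=> setT) phi 1) => //=.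
- by rewrite canonical_measure_setT.
- by rewrite probability_le1.
- by rewrite ler01 lexx.
- exact: nearW.
- move=> B mB; rewrite mul1e.
  apply: cvg_trans (cvg_canonical_measure_preimage lambda _ mB).
  by apply: near_eq_cvg; apply: nearW => i; rewrite setIT.
Qed.

End canonical_relaxation.

(* By invariance, [mu (phi_t^-1 A `&` B) = mu (A `&` phi_(-t)^-1 B)], so mixing
   at +oo is also mixing at -oo. *)
Lemma mixing_ninfty {d} {X : measurableType d} {R : realType}
    (mu : probability X R) (T : set R) (phi : R -> X -> X) :
  [set - t | t in T] = T ->
  (forall t, T t -> measurable_fun setT (phi t)) ->
  (forall t, T t -> invariant_measure mu (phi t)) ->
  (forall t, T t -> cancel (phi (- t)) (phi t)) ->
  mixing mu T phi ->
  forall A B, measurable A -> measurable B ->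
  mu (phi t @^-1` A `&` B) @[t --> within T -oo] --> (mu A * mu B)%E.
Proof.
move=> TN mphi invphi phiK mix A B mA mB.
have TNt t : T t -> T (- t) by move=> Tt; rewrite -TN; exists t.
(* Since [T] is symmetric, time reversal carries the filter at -oo within [T] to the one at +oo. *)
have oppT : (- t)%R @[t --> within T -oo] --> within T +oo.
  move=> P; rewrite /within/= -ninftyN => TP.
  by apply: (@filterS _ -oo _ _ _ _ TP) => t /= + Tt; apply; exact: TNt.
(* Mixing is taken with [A] and [B] exchanged, since the preimage moves from [A] to [B] under time
   reversal. *)
have mixN : mu (phi (- t) @^-1` B `&` A) @[t --> within T -oo] -->
    (mu B * mu A)%E.
  exact: (cvg_comp (fun t : R => - t) (fun t => mu (phi t @^-1` B `&` A)) oppT (mix _ _ mB mA)).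
rewrite muleC; apply: cvg_trans mixN; apply: near_eq_cvg; near=> t.
have Tt : T t by near: t; exact: withinT.
have mtA : measurable (phi t @^-1` A).
  by rewrite -[X in measurable X]setTI; exact: mphi.
(* Invariance under [phi (- t)] pulls the whole intersection back; [phi t] then cancels on the [A]
   side. *)
rewrite /= -(invphi _ (TNt _ Tt) (phi t @^-1` A `&` B)); last exact: measurableI.
rewrite /pushforward; congr (mu _).
by apply/seteqP; split => x [/=]; rewrite phiK.
Unshelve. all: by end_near. Qed.

Theorem mainTheorem8 (R : realType) (X : completeMetricType R)
    (X_separable : separable X) (mu : probability (borel X) R)
    (g : {mfun borel X >-> R}) (g_bounded : bounded_fun g)
    (g_continuous_ae : {ae mu, forall x : X, continuous_at x (g : X -> R)})
    (T : set R) (T0 : T 0) (T_unbounded : ~ has_ubound T)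
    (phi : R -> X -> X)
    (phi_measurable : forall t, T t ->
      measurable_fun [set: borel X] (phi t : borel X -> borel X))
    (phi_continuous_ae : forall t, T t ->
      {ae mu, forall x : X, continuous_at x (phi t)})
    (phi0 : phi 0 = id)
    (theta_bij : theta_invertible mu g)
    (phi_invariant : forall t, T t -> invariant_measure mu (phi t))
    (phi_mixing : mixing mu T phi) :
  (forall y, y_min g < y < y_max g ->
     psi mu g phi t y @[t --> within T +oo] --> y_star mu g) /\
  ([set - t | t in T] = T ->
   (forall t, T t -> cancel (phi t) (phi (- t)) /\
                     cancel (phi (- t)) (phi t)) ->
   forall y, y_min g < y < y_max g ->
     psi mu g phi t y @[t --> within T -oo] --> y_star mu g).
Proof.
move=> {X_separable g_continuous_ae T0 T_unbounded phi_continuous_ae phi0}.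
split=> [y _|TN phiK y _].
  (* [psi] unfolds to the canonical expectation at the real parameter [fine (theta_inv y)]. *)
  apply: (cvg_canonical_expectation mu g g_bounded _ phi) => //.
  by rewrite near_withinE; apply: nearW => t; exact: phi_measurable.
apply: (cvg_canonical_expectation mu g g_bounded _ phi) => //.
  by rewrite near_withinE; apply: nearW => t; exact: phi_measurable.
apply: mixing_ninfty => // t Tt.
by have [] := phiK t Tt.
Qed.
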